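(* Let $F\colon \mathbf{A}\to\mathbf{C}$ and $G\colon\mathbf{B}\to\mathbf{C}$ be lenses between small categories, and let the lens span $\mathbf{A}\xleftarrow{\overline{G}}\mathbf{D}\xrightarrow{\overline{F}}\mathbf{B}$ be a proxy pullback of the lens cospan $(F,G)$. Let $\mathbf{A}\xleftarrow{K}\mathbf{E}\xrightarrow{J}\mathbf{B}$ be a lens span which is independent and is compatible with the cospan $(F,G)$. If the span $(\overline{G},\overline{F})$ is sync minimal, then there is a unique lens $L\colon\mathbf{E}\to\mathbf{D}$ such that $\overline{G}\circ L=K$ and $\overline{F}\circ L=J$ (as lenses).
   Context: All categories are small. A lens (asymmetric delta lens) $F\colon\mathbf{A}\to\mathbf{B}$ is a functor $F\colon\mathbf{A}\to\mathbf{B}$ (its get functor) together with, for each object $A$ of $\mathbf{A}$ and each morphism $b$ of $\mathbf{B}$ with source $FA$, a chosen morphism $F^{A}b$ of $\mathbf{A}$ with source $A$ (the lift of $b$), such that $F(F^{A}b)=b$, $F^{A}\mathrm{id}_{FA}=\mathrm{id}_A$, and $F^{A}(b'\circ b)=F^{A'}b'\circ F^{A}b$, where $A'$ is the target of $F^{A}b$. The composite of lenses $F\colon\mathbf{A}\to\mathbf{B}$ and $G\colon\mathbf{B}\to\mathbf{C}$ is the composite functor $G\circ F$ with lifts $(G\circ F)^{A}c=F^{A}(G^{FA}c)$. Equality of lenses (and commutativity of diagrams of lenses) means equality of both functors and lifts. $\mathbf{Lens}$ is the category of small categories and lenses. A lens span $\mathbf{A}\xleftarrow{K}\mathbf{E}\xrightarrow{J}\mathbf{B}$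 is compatible with a lens cospan $\mathbf{A}\xrightarrow{F}\mathbf{C}\xleftarrow{G}\mathbf{B}$ (equivalently, the square is a compatible lens square) if $F\circ K=G\circ J$ as lenses, and for all objects $E$ of $\mathbf{E}$, all morphisms $a$ of $\mathbf{A}$ with source $KE$ and all morphisms $b$ of $\mathbf{B}$ with source $JE$, we have $J(K^{E}a)=G^{JE}(Fa)$ and $K(J^{E}b)=F^{KE}(Gb)$. A proxy pullback of a lens cospan $(F,G)$ is a lens span compatible with $(F,G)$ such that the underlying square of get functors is a pullback square in the category of small categories and functors. A lens span $\mathbf{A}\xleftarrow{F}\mathbf{C}\xrightarrow{G}\mathbf{B}$ is sync minimal if every morphism of $\mathbf{C}$ is a composite of a finite sequence of morphisms $c_k\colon C_k\to C_{k+1}$ of $\mathbf{C}$ such that, for each $k$, either $c_k=F^{C_k}Fc_k$ or $c_k=G^{C_k}Gc_k$. The sync-minimal core $\mathscr{M}(F,G)$ of a lens span $(F,G)$ is the lens span from $\mathbf{A}$ to $\mathbf{B}$ obtained by replacing $\mathbf{C}$ by its subcategory with the same objects and with only those morphisms that are composites of finite sequences of lifts along $F$ or $G$, with $F$ and $G$ (functors and lifts) restricted accordingly. A lens span $(F,G)$ is independent if, for all morphisms $c,c'$ in the apex of $\mathscr{M}(F,G)$ with the same source, whenever $Fc=Fc'$ and $Gc=Gc'$, also $c=c'$. *)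

(* Defs.v *)
From Stdlib Require Import ProofIrrelevance FunctionalExtensionality.

Set Implicit Arguments.
Unset Strict Implicit.
Unset Printing Implicit Defensive.

#[local] Obligation Tactic := cbn; intros.

(* Functors and lenses are compared by strict equality, so small categories are
   given by a type of objects and a type of morphisms with source and target
   maps, rather than by a family of hom-types.  Composability is a proof
   argument of [comp].  Throughout, every equation whose two sides need such
   proofs quantifies over them; those proofs are always derivable from the
   other data, so the quantification is not an extra hypothesis. *)

Record category := Category {
  Ob : Type;
  Mor : Type;
  src : Mor -> Ob;
  tgt : Mor -> Ob;
  idm : Ob -> Mor;
  comp : forall g f : Mor, tgt f = src g -> Mor;
  src_id : forall X, src (idm X) = X;
  tgt_id : forall X, tgt (idm X) = X;
  src_comp : forall g f (p : tgt f = src g), src (comp p) = src f;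
  tgt_comp : forall g f (p : tgt f = src g), tgt (comp p) = tgt g;
  comp_id_l : forall f (p : tgt f = src (idm (tgt f))), comp p = f;
  comp_id_r : forall f (p : tgt (idm (src f)) = src f), comp p = f;
  comp_assoc : forall h g f (p : tgt f = src g) (q : tgt g = src h)
      (r : tgt (@comp g f p) = src h) (s : tgt f = src (@comp h g q)),
    @comp h (@comp g f p) r = @comp (@comp h g q) f s
}.

Arguments src {c} _.
Arguments tgt {c} _.
Arguments idm {c} _.
Arguments comp {c} g f _.

Record functor (A B : category) := Functor {
  fob : Ob A -> Ob B;
  fmor : Mor A -> Mor B;
  fmor_src : forall f, src (fmor f) = fob (src f);
  fmor_tgt : forall f, tgt (fmor f) = fob (tgt f);
  fmor_id : forall X, fmor (idm X) = idm (fob X);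
  fmor_comp : forall g f (p : tgt f = src g) (q : tgt (fmor f) = src (fmor g)),
    fmor (comp g f p) = comp (fmor g) (fmor f) q
}.

Lemma functor_ext (A B : category) (F G : functor A B) :
  (forall X, fob F X = fob G X) -> (forall f, fmor F f = fmor G f) -> F = G.
Proof.
destruct F as [Fo Fm a b c d], G as [Go Gm a' b' c' d']; cbn; intros Ho Hm.
apply functional_extensionality in Ho; apply functional_extensionality in Hm.
subst Go Gm; f_equal; apply proof_irrelevance.
Qed.

Program Definition comp_functor (A B C : category)
    (G : functor B C) (F : functor A B) : functor A C :=
  {| fob := fun X => fob G (fob F X);
     fmor := fun f => fmor G (fmor F f) |}.
Next Obligation. now rewrite !fmor_src. Qed.
Next Obligation. now rewrite !fmor_tgt. Qed.
Next Obligation. now rewrite !fmor_id. Qed.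
Next Obligation.
assert (r : tgt (fmor F f) = src (fmor F g)).
{ now rewrite fmor_src, fmor_tgt, p. }
now rewrite (fmor_comp p r), (fmor_comp r q).
Qed.

(* [lift F X b p] is the lift F^X b of [b], whose source is FX by [p]. *)
Record lens (A B : category) := Lens {
  get :> functor A B;
  lift : forall (X : Ob A) (b : Mor B), src b = fob get X -> Mor A;
  src_lift : forall X b (p : src b = fob get X), src (lift p) = X;
  get_lift : forall X b (p : src b = fob get X), fmor get (lift p) = b;
  lift_id : forall X (p : src (idm (fob get X)) = fob get X), lift p = idm X;
  lift_comp : forall X b b' (p : src b = fob get X) (q : tgt b = src b')
      (r : src (comp b' b q) = fob get X)
      (s : src b' = fob get (tgt (@lift X b p)))
      (t : tgt (@lift X b p) = src (@lift (tgt (@lift X b p)) b' s)),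
    @lift X (comp b' b q) r =
    comp (@lift (tgt (@lift X b p)) b' s) (@lift X b p) t
}.

Arguments lift {A B} l X b _.

Lemma lens_ext (A B : category) (F G : lens A B) :
  (forall X, fob F X = fob G X) -> (forall f, fmor F f = fmor G f) ->
  (forall X b (p : src b = fob F X) (q : src b = fob G X),
    lift F X b p = lift G X b q) ->
  F = G.
Proof.
intros Ho Hm Hl.
pose proof (functor_ext Ho Hm) as HFG.
destruct F as [F Fl a b c d], G as [G Gl a' b' c' d']; cbn in *.
subst G.
assert (Fl = Gl) as <-.
{ extensionality X; extensionality x; extensionality p; apply Hl. }
f_equal; apply proof_irrelevance.
Qed.

Program Definition comp_lens (A B C : category)
    (G : lens B C) (F : lens A B) : lens A C :=
  {| get := comp_functor G F;
     lift := fun X c p =>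
       lift F X (lift G (fob F X) c p) (src_lift p) |}.
Next Obligation. apply src_lift. Qed.
Next Obligation. now rewrite !get_lift. Qed.
Next Obligation.
generalize (src_lift p); rewrite lift_id; intros; apply lift_id.
Qed.
Next Obligation.
set (x := lift G (fob F X) b p) in *.
set (y := lift F X x (src_lift p)) in *.
assert (e : fob F (tgt y) = tgt x).
{ rewrite <- fmor_tgt; unfold y; now rewrite get_lift. }
assert (s' : src b' = fob G (tgt x)) by now rewrite <- e.
assert (H : forall Y (u : src b' = fob G Y), Y = tgt x ->
    lift G Y b' u = lift G (tgt x) b' s').
{ intros Y u ->; f_equal; apply proof_irrelevance. }
revert t; generalize (src_lift s); rewrite (H _ _ e); intros s2 t.
assert (t' : tgt x = src (lift G (tgt x) b' s')) by now rewrite src_lift.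
generalize (src_lift r); rewrite (lift_comp (p := p) r (s := s') t').
intros r'; apply (lift_comp (p := src_lift p)).
Qed.

Definition is_pullback (A B C D : category)
    (F : functor A C) (G : functor B C)
    (P : functor D A) (Q : functor D B) : Prop :=
  comp_functor F P = comp_functor G Q /\
  forall (X : category) (U : functor X A) (V : functor X B),
    comp_functor F U = comp_functor G V ->
    exists! W : functor X D, comp_functor P W = U /\ comp_functor Q W = V.

Definition compatible (A B C E : category) (F : lens A C) (G : lens B C)
    (K : lens E A) (J : lens E B) : Prop :=
  comp_lens F K = comp_lens G J /\
  (forall (X : Ob E) (a : Mor A) (p : src a = fob K X)
      (q : src (fmor F a) = fob G (fob J X)),
    fmor J (lift K X a p) = lift G (fob J X) (fmor F a) q) /\
  (forall (X : Ob E) (b : Mor B) (p : src b = fob J X)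
      (q : src (fmor G b) = fob F (fob K X)),
    fmor K (lift J X b p) = lift F (fob K X) (fmor G b) q).

Definition proxy_pullback (A B C D : category) (F : lens A C) (G : lens B C)
    (P : lens D A) (Q : lens D B) : Prop :=
  compatible F G P Q /\ is_pullback F G P Q.

(* The empty sequence is allowed, with composite an identity; identities are
   lifts of identities, so this does not matter below. *)
Inductive composite_of (C : category) (P : Mor C -> Prop) : Mor C -> Prop :=
| composite_nil X : composite_of P (idm X)
| composite_cons c f (p : tgt c = src f) :
    P c -> composite_of P f -> composite_of P (comp f c p).

Lemma composite_single (C : category) (P : Mor C -> Prop) c :
  P c -> composite_of P c.
Proof.
intros Hc.
assert (p : tgt c = src (idm (tgt c))) by now rewrite src_id.
rewrite <- (comp_id_l p); apply composite_cons; [exact Hc | apply composite_nil].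
Qed.

Lemma composite_comp (C : category) (P : Mor C -> Prop) g f
    (p : tgt f = src g) :
  composite_of P f -> composite_of P g -> composite_of P (comp g f p).
Proof.
intros Hf Hg; induction Hf as [X | c f q Hc Hf IH].
- assert (X = src g) as -> by now rewrite <- p, tgt_id.
  now rewrite comp_id_r.
- assert (p' : tgt f = src g) by now rewrite <- p, tgt_comp.
  assert (q' : tgt c = src (comp g f p')) by now rewrite src_comp.
  rewrite (comp_assoc (q := p') _ q'); apply composite_cons; auto.
Qed.

Definition sync_minimal (A B C : category) (F : lens C A) (G : lens C B) :
    Prop :=
  forall c : Mor C,
    composite_of (fun c =>
      c = lift F (src c) (fmor F c) (fmor_src F c) \/
      c = lift G (src c) (fmor G c) (fmor_src G c)) c.

Lemma sub_mor_eq (C : category) (P : Mor C -> Prop) (f g : {f | P f}) :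
  proj1_sig f = proj1_sig g -> f = g.
Proof. apply eq_sig_hprop; intros; apply proof_irrelevance. Qed.

Definition comp_closed (C : category) (P : Mor C -> Prop) : Prop :=
  forall g f (p : tgt f = src g), P f -> P g -> P (comp g f p).

Program Definition wide_subcategory (C : category) (P : Mor C -> Prop)
    (P_id : forall X, P (idm X)) (P_comp : comp_closed P) : category :=
  {| Ob := Ob C;
     Mor := {f | P f};
     src := fun f => src (proj1_sig f);
     tgt := fun f => tgt (proj1_sig f);
     idm := fun X => exist P (idm X) (P_id X);
     comp := fun g f p =>
       exist P (comp (proj1_sig g) (proj1_sig f) p)
         (P_comp _ _ p (proj2_sig f) (proj2_sig g)) |}.
Next Obligation. apply src_id. Qed.
Next Obligation. apply tgt_id. Qed.
Next Obligation. apply src_comp. Qed.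
Next Obligation. apply tgt_comp. Qed.
Next Obligation. apply sub_mor_eq, comp_id_l. Qed.
Next Obligation. apply sub_mor_eq, comp_id_r. Qed.
Next Obligation. apply sub_mor_eq, comp_assoc. Qed.

Program Definition restrict_functor (C : category) (P : Mor C -> Prop)
    (P_id : forall X, P (idm X)) (P_comp : comp_closed P)
    (A : category) (F : functor C A) :
    functor (wide_subcategory P_id P_comp) A :=
  {| fob := fun X : Ob (wide_subcategory P_id P_comp) => fob F X;
     fmor := fun f : Mor (wide_subcategory P_id P_comp) =>
       fmor F (proj1_sig f) |}.
Next Obligation. apply fmor_src. Qed.
Next Obligation. apply fmor_tgt. Qed.
Next Obligation. apply fmor_id. Qed.
Next Obligation. apply fmor_comp. Qed.

Program Definition restrict_lens (C : category) (P : Mor C -> Prop)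
    (P_id : forall X, P (idm X)) (P_comp : comp_closed P)
    (A : category) (F : lens C A)
    (P_lift : forall X a (p : src a = fob F X), P (lift F X a p)) :
    lens (wide_subcategory P_id P_comp) A :=
  {| get := restrict_functor P_id P_comp F;
     lift := fun (X : Ob (wide_subcategory P_id P_comp)) a p =>
       exist P (lift F X a p) (P_lift X a p) |}.
Next Obligation. apply src_lift. Qed.
Next Obligation. apply get_lift. Qed.
Next Obligation. apply sub_mor_eq, lift_id. Qed.
Next Obligation. apply sub_mor_eq, lift_comp. Qed.

Definition is_lift (A C : category) (F : lens C A) (c : Mor C) : Prop :=
  exists X a (p : src a = fob F X), c = lift F X a p.

Definition lift_composite (A B C : category) (F : lens C A) (G : lens C B) :
    Mor C -> Prop :=
  composite_of (fun c => is_lift F c \/ is_lift G c).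

Lemma lift_composite_left (A B C : category) (F : lens C A) (G : lens C B)
    X a (p : src a = fob F X) : lift_composite F G (lift F X a p).
Proof. apply composite_single; left; now exists X, a, p. Qed.

Lemma lift_composite_right (A B C : category) (F : lens C A) (G : lens C B)
    X b (p : src b = fob G X) : lift_composite F G (lift G X b p).
Proof. apply composite_single; right; now exists X, b, p. Qed.

Definition core_apex (A B C : category) (F : lens C A) (G : lens C B) :
    category :=
  @wide_subcategory C (lift_composite F G)
    (@composite_nil C _) (@composite_comp C _).

Definition core_left (A B C : category) (F : lens C A) (G : lens C B) :
    lens (core_apex F G) A :=
  @restrict_lens C (lift_composite F G) _ _ A F (@lift_composite_left A B C F G).

Definition core_right (A B C : category) (F : lens C A) (G : lens C B) :
    lens (core_apex F G) B :=
  @restrict_lens C (lift_composite F G) _ _ B G (@lift_composite_right A B C F G).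

Definition independent (A B C : category) (F : lens C A) (G : lens C B) :
    Prop :=
  forall c c' : Mor (core_apex F G),
    src c = src c' ->
    fmor (core_left F G) c = fmor (core_left F G) c' ->
    fmor (core_right F G) c = fmor (core_right F G) c' ->
    c = c'.

(* Main.v *)
Require Import Defs.
From Stdlib Require Import ProofIrrelevance IndefiniteDescription.

(** Since the square of get functors is a pullback, the get functor of the
    required lens can only be the mediating functor [W] from [E] to [D], and
    the work lies in the lifts.

    Compatibility of both squares forces [W] to send each chosen lift along [K]
    to the chosen lift along [Gbar] of the same morphism: the two have the same
    image in [A] because lifts are sections of get, the same image in [B]
    because compatibility computes both as the same lift along [G], and a
    morphism of [D] is determined by its images in [A] and [B]
    ([pullback_jointly_monic], [mediating_lift]).  Likewise for [J] and [Fbar].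
    As [D] is sync minimal, every morphism [d] out of [W X] is a composite of
    such lifts, so replacing them one by one by lifts along [K] and [J] yields a
    morphism out of [X] in the sync-minimal core of [(K, J)] which lies over [d]
    ([core_lift_exists]).  Independence says that there is only one.  So [W],
    restricted to the core of [(K, J)], is a discrete opfibration, and unique
    lifts automatically respect identities and composites
    ([lens_of_wide_discrete_opfibration]).

    Conversely, if [L] is any lens whose composites with [Gbar] and [Fbar] are
    [K] and [J], it lifts composites of lifts to composites of lifts, so its
    lifts all lie in the core ([lift_in_core]), and independence determines
    them. *)

Set Implicit Arguments.
Unset Strict Implicit.
Unset Printing Implicit Defensive.

#[local] Obligation Tactic := cbn; intros.
#[local] Unset Program Cases.

(** * Transport along equalities *)

Lemma functor_eq_ob (A B : category) (F G : functor A B) :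
  F = G -> forall X, fob F X = fob G X.
Proof. now intros ->. Qed.

Lemma functor_eq_mor (A B : category) (F G : functor A B) :
  F = G -> forall f, fmor F f = fmor G f.
Proof. now intros ->. Qed.

Lemma lift_congr (A B : category) (F G : lens A B) X Y b c
    (p : src b = fob F X) (q : src c = fob G Y) :
  F = G -> X = Y -> b = c -> lift F X b p = lift G Y c q.
Proof. intros -> -> ->; f_equal; apply proof_irrelevance. Qed.

Lemma comp_congr (C : category) (g g' f f' : Mor C)
    (p : tgt f = src g) (q : tgt f' = src g') :
  g = g' -> f = f' -> comp g f p = comp g' f' q.
Proof. intros -> ->; f_equal; apply proof_irrelevance. Qed.

(** * Pullbacks are jointly monic on morphisms *)

Inductive arrow_mor := arrow_id (X : bool) | arrow_gen.

(** Functors out of this category are the morphisms of their codomain, so on it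
    uniqueness of functors says something about single morphisms. *)
Program Definition walking_arrow : category :=
  {| Ob := bool;
     Mor := arrow_mor;
     src := fun f => match f with arrow_id X => X | arrow_gen => false end;
     tgt := fun f => match f with arrow_id X => X | arrow_gen => true end;
     idm := arrow_id;
     comp := fun g f _ => match f with arrow_id _ => g | arrow_gen => f end |}.
Next Obligation. reflexivity. Qed.
Next Obligation. reflexivity. Qed.
Next Obligation. now destruct f. Qed.
Next Obligation. now destruct f; destruct g. Qed.
Next Obligation. now destruct f. Qed.
Next Obligation. now destruct f. Qed.
Next Obligation. now destruct f. Qed.

Program Definition arrow_functor (D : category) (d : Mor D) :
    functor walking_arrow D :=
  {| fob := fun X : Ob walking_arrow => if X then tgt d else src d;
     fmor := fun f : Mor walking_arrow =>
       match f with
       | arrow_id X => idm (if X then tgt d else src d)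
       | arrow_gen => d
       end |}.
Next Obligation. destruct f; [apply src_id | reflexivity]. Qed.
Next Obligation. destruct f; [apply tgt_id | reflexivity]. Qed.
Next Obligation. reflexivity. Qed.
Next Obligation.
destruct f as [X |].
- assert (H : forall (Z : Ob D) g (r : tgt (idm Z) = src g), g = comp g (idm Z) r).
  { intros Z g' r; assert (Z = src g') as -> by now rewrite <- r, tgt_id.
    now rewrite comp_id_r. }
  destruct g as [Y |]; cbn in *; subst; apply H.
- destruct g as [Y |]; cbn in *; [subst | discriminate].
  symmetry; apply comp_id_l.
Qed.

Lemma comp_arrow_functor (D A : category) (P : functor D A) (d : Mor D) :
  comp_functor P (arrow_functor d) = arrow_functor (fmor P d).
Proof.
apply functor_ext.
- now intros []; cbn; rewrite ?fmor_src, ?fmor_tgt.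
- intros [[] |]; cbn; now rewrite ?fmor_id, ?fmor_src, ?fmor_tgt.
Qed.

(** Test the uniqueness of mediating functors on the walking arrow. *)
Lemma pullback_jointly_monic (A B C D : category)
    (F : functor A C) (G : functor B C) (P : functor D A) (Q : functor D B)
    (hpb : is_pullback F G P Q) (d d' : Mor D) :
  fmor P d = fmor P d' -> fmor Q d = fmor Q d' -> d = d'.
Proof.
intros HP HQ; destruct hpb as [Hsq Huniv].
destruct (Huniv walking_arrow (comp_functor P (arrow_functor d))
            (comp_functor Q (arrow_functor d))) as (W & _ & HW).
{ rewrite !comp_arrow_functor; cbn; f_equal.
  exact (functor_eq_mor Hsq d). }
assert (H : arrow_functor d = arrow_functor d').
{ transitivity W; [symmetry |]; apply HW; split; trivial;
    rewrite !comp_arrow_functor; now f_equal. }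
exact (functor_eq_mor H arrow_gen).
Qed.

(** * Lifting along the mediating functor *)

Lemma compatible_sym (A B C E : category) (F : lens A C) (G : lens B C)
    (K : lens E A) (J : lens E B) :
  compatible F G K J -> compatible G F J K.
Proof. intros (H1 & H2 & H3); split; [now symmetry | now split]. Qed.

(** The two lifts agree under [P] because both lie over [a].  They agree under
    [Q] because compatibility makes the image of each the lift along [G] of
    [F a]. *)
Lemma mediating_lift (A B C D E : category) (F : lens A C) (G : lens B C)
    (P : lens D A) (Q : lens D B) (K : lens E A) (J : lens E B)
    (hPQ : compatible F G P Q) (hKJ : compatible F G K J)
    (hmonic : forall d d' : Mor D,
      fmor P d = fmor P d' -> fmor Q d = fmor Q d' -> d = d')
    (W : functor E D) (hK : comp_functor P W = K) (hJ : comp_functor Q W = J)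
    X a (p : src a = fob K X) (q : src a = fob P (fob W X)) :
  fmor W (lift K X a p) = lift P (fob W X) a q.
Proof.
apply hmonic.
- rewrite get_lift; transitivity (fmor K (lift K X a p)).
  + exact (functor_eq_mor hK (lift K X a p)).
  + apply get_lift.
- destruct hPQ as (sqD & HQ & _), hKJ as (sqE & HJ & _).
  assert (r : src (fmor F a) = fob G (fob J X)).
  { rewrite fmor_src, p.
    exact (functor_eq_ob (f_equal (@get _ _) sqE) X). }
  assert (s : src (fmor F a) = fob G (fob Q (fob W X))).
  { rewrite fmor_src, q.
    exact (functor_eq_ob (f_equal (@get _ _) sqD) (fob W X)). }
  rewrite (HQ _ _ _ s).
  transitivity (fmor J (lift K X a p)).
  { exact (functor_eq_mor hJ (lift K X a p)). }
  rewrite (HJ _ _ _ r).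
  apply lift_congr; trivial.
  symmetry; exact (functor_eq_ob hJ X).
Qed.

(** Sync minimality allows induction on [d]: each factor is a lift along [P] or
    [Q], hence the image under [W] of the corresponding lift along [K] or [J],
    and the next factor then starts at the image of the target of that lift. *)
Lemma core_lift_exists (A B D E : category)
    (P : lens D A) (Q : lens D B) (K : lens E A) (J : lens E B)
    (hsync : sync_minimal P Q) (W : functor E D)
    (hK : comp_functor P W = K) (hJ : comp_functor Q W = J)
    (hliftK : forall X a (p : src a = fob K X) (q : src a = fob P (fob W X)),
      fmor W (lift K X a p) = lift P (fob W X) a q)
    (hliftJ : forall X b (p : src b = fob J X) (q : src b = fob Q (fob W X)),
      fmor W (lift J X b p) = lift Q (fob W X) b q)
    X (d : Mor D) :
  src d = fob W X ->
  exists e, lift_composite K J e /\ src e = X /\ fmor W e = d.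
Proof.
revert X; induction (hsync d) as [Y | c f p Hc Hf IH]; intros X HX.
- exists (idm X); split; [apply composite_nil |].
  rewrite src_id in HX; subst Y; split; [apply src_id | apply fmor_id].
- rewrite src_comp in HX.
  assert (exists k, lift_composite K J k /\ src k = X /\ fmor W k = c)
    as (k & Hk & Hks & Hkc).
  { destruct Hc as [Hc | Hc].
    - assert (q : src (fmor P c) = fob P (fob W X)) by now rewrite fmor_src, HX.
      assert (r : src (fmor P c) = fob K X)
        by (rewrite q; exact (functor_eq_ob hK X)).
      exists (lift K X (fmor P c) r).
      split; [apply lift_composite_left | split; [apply src_lift |]].
      rewrite (hliftK _ _ r q).
      etransitivity; [| symmetry; exact Hc]; now apply lift_congr.
    - assert (q : src (fmor Q c) = fob Q (fob W X)) by now rewrite fmor_src, HX.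
      assert (r : src (fmor Q c) = fob J X)
        by (rewrite q; exact (functor_eq_ob hJ X)).
      exists (lift J X (fmor Q c) r).
      split; [apply lift_composite_right | split; [apply src_lift |]].
      rewrite (hliftJ _ _ r q).
      etransitivity; [| symmetry; exact Hc]; now apply lift_congr. }
  destruct (IH (tgt k)) as (m & Hm & Hms & Hmf).
  { now rewrite <- fmor_tgt, Hkc. }
  assert (t : tgt k = src m) by now symmetry.
  exists (comp m k t); split; [now apply composite_comp | split].
  + now rewrite src_comp.
  + assert (u : tgt (fmor W k) = src (fmor W m)) by now rewrite Hkc, Hmf.
    rewrite (fmor_comp t u); now apply comp_congr.
Qed.

(** Unique lifts satisfy the lens laws because [N] contains identities and is
    closed under composition, so both sides of each law are lifts in [N]. *)
Lemma lens_of_wide_discrete_opfibration (E D : category) (W : functor E D)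
    (N : Mor E -> Prop) (N_id : forall X, N (idm X)) (N_comp : comp_closed N)
    (N_lift : forall X d, src d = fob W X ->
      exists! e, N e /\ src e = X /\ fmor W e = d) :
  exists L : lens E D,
    get L = W /\ forall X d (p : src d = fob L X), N (lift L X d p).
Proof.
set (l := fun X d (p : src d = fob W X) =>
  constructive_indefinite_description _ (N_lift X d p)).
assert (Hl : forall X d p, N (proj1_sig (l X d p)) /\
    src (proj1_sig (l X d p)) = X /\ fmor W (proj1_sig (l X d p)) = d)
  by (intros; apply (proj2_sig (l X d p))).
assert (Hu : forall X d p e, N e -> src e = X -> fmor W e = d ->
    proj1_sig (l X d p) = e)
  by (intros; now apply (proj2_sig (l X d p))).
clearbody l.
unshelve eexists (@Lens E D W (fun X d p => proj1_sig (l X d p)) _ _ _ _).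
- intros; apply Hl.
- intros; apply Hl.
- intros X p; apply Hu; [apply N_id | apply src_id | apply fmor_id].
- intros X b b' p q r s t.
  destruct (Hl X b p) as (H1 & H2 & H3), (Hl _ b' s) as (H1' & H2' & H3').
  apply Hu; [now apply N_comp | now rewrite src_comp |].
  unshelve erewrite fmor_comp; [now rewrite H3, H3' | now apply comp_congr].
- split; [reflexivity | intros; apply Hl].
Qed.

(** * Uniqueness of lifts *)

Lemma independent_eq (A B E : category) (K : lens E A) (J : lens E B)
    (hind : independent K J) (e e' : Mor E) :
  lift_composite K J e -> lift_composite K J e' -> src e = src e' ->
  fmor K e = fmor K e' -> fmor J e = fmor J e' -> e = e'.
Proof.
intros He He' Hs HK HJ.
exact (f_equal (@proj1_sig _ _)
  (hind (exist _ e He) (exist _ e' He') Hs HK HJ)).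
Qed.

(** Lifting along [L] preserves composites, and the lift along [L] of a lift
    along [P] is by definition a lift along the composite lens. *)
Lemma lift_in_core (A B D E : category) (P : lens D A) (Q : lens D B)
    (hsync : sync_minimal P Q) (L : lens E D) X d (p : src d = fob L X) :
  lift_composite (comp_lens P L) (comp_lens Q L) (lift L X d p).
Proof.
revert X p; induction (hsync d) as [Y | c f q Hc Hf IH]; intros X p.
- assert (r : src (idm (fob L X)) = fob L X) by apply src_id.
  rewrite (lift_congr p r); trivial.
  + rewrite lift_id; apply composite_nil.
  + f_equal; now rewrite <- p, src_id.
- assert (r : src c = fob L X) by now rewrite <- p, src_comp.
  assert (s : src f = fob L (tgt (lift L X c r))).
  { now rewrite <- fmor_tgt, get_lift. }
  assert (t : tgt (lift L X c r) = src (lift L _ f s)) by now rewrite src_lift.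
  rewrite (lift_comp p t); apply composite_comp; [| apply IH].
  apply composite_single.
  destruct Hc as [Hc | Hc]; [left; exists X, (fmor P c) | right; exists X, (fmor Q c)];
    (unshelve eexists; [cbn; now rewrite fmor_src, r |]);
    cbn; apply lift_congr; trivial;
    (etransitivity; [exact Hc | now apply lift_congr]).
Qed.

(** * The universal property *)

Theorem theorem6p1 (A B C D E : category)
    (F : lens A C) (G : lens B C)
    (Gbar : lens D A) (Fbar : lens D B)
    (hD : proxy_pullback F G Gbar Fbar)
    (K : lens E A) (J : lens E B)
    (hind : independent K J)
    (hcomp : compatible F G K J)
    (hsync : sync_minimal Gbar Fbar) :
  exists! L : lens E D, comp_lens Gbar L = K /\ comp_lens Fbar L = J.
Proof.
destruct hD as [hDcomp hpb].
assert (hmonic := pullback_jointly_monic hpb).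
destruct (proj2 hpb E K J) as (W & [hK hJ] & hW).
{ exact (f_equal (@get _ _) (proj1 hcomp)). }
assert (hliftK := mediating_lift hDcomp hcomp hmonic hK hJ).
assert (hliftJ := mediating_lift (compatible_sym hDcomp) (compatible_sym hcomp)
  (fun d d' HQ HP => hmonic d d' HP HQ) hJ hK).
(* [K] and [J] factor through [W], so independence makes [W] faithful on core
   morphisms with a common source. *)
assert (hdet : forall e e', lift_composite K J e -> lift_composite K J e' ->
    src e = src e' -> fmor W e = fmor W e' -> e = e').
{ intros e e' He He' Hs HW; apply (independent_eq hind); trivial.
  - rewrite <- !(functor_eq_mor hK); cbn; now rewrite HW.
  - rewrite <- !(functor_eq_mor hJ); cbn; now rewrite HW. }
destruct (@lens_of_wide_discrete_opfibration E D W (lift_composite K J))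
  as (L & hL & hLcore).
{ apply composite_nil. }
{ exact (@composite_comp E _). }
{ intros X d HX.
  destruct (core_lift_exists hsync hK hJ hliftK hliftJ HX)
    as (e & He & Hs & Hd).
  exists e; split; [now split |].
  intros e' (He' & Hs' & Hd'); apply hdet; trivial; congruence. }
subst W.
exists L; split; [split |].
- apply lens_ext; [exact (functor_eq_ob hK) | exact (functor_eq_mor hK) |].
  intros X a p q; cbn; apply hdet.
  + apply hLcore.
  + apply lift_composite_left.
  + transitivity X; [| symmetry]; apply src_lift.
  + rewrite get_lift; symmetry; apply hliftK.
- apply lens_ext; [exact (functor_eq_ob hJ) | exact (functor_eq_mor hJ) |].
  intros X b p q; cbn; apply hdet.
  + apply hLcore.
  + apply lift_composite_right.
  + transitivity X; [| symmetry]; apply src_lift.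
  + rewrite get_lift; symmetry; apply hliftJ.
- intros L' [hK' hJ'].
  assert (HL : get L = get L').
  { apply hW; split; [exact (f_equal (@get _ _) hK') |
                      exact (f_equal (@get _ _) hJ')]. }
  apply lens_ext; [exact (functor_eq_ob HL) | exact (functor_eq_mor HL) |].
  intros X d p q; apply hdet.
  + apply hLcore.
  + generalize (lift_in_core hsync q); now rewrite hK', hJ'.
  + transitivity X; [| symmetry]; apply src_lift.
  + now rewrite get_lift, HL, get_lift.
Qed.
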